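(* Let $\alpha$ be a quadratic unit greater than $1$, i.e.\ $\alpha=(b+\sqrt{b^2-4})/2$ with an integer $b\ge3$ or $\alpha=(b+\sqrt{b^2+4})/2$ with an integer $b\ge1$, and suppose $\alpha\ge3$. Then there exists $\kappa<1/2$ such that \[ [\kappa,1/2]\subset\mathcal{L}(\alpha)=\left\{\limsup_{n\to\infty}\|\xi\alpha^n\| : \xi\in\mathbb{R}\right\}. \] In particular, $\mathcal{L}(\alpha)$ has positive Lebesgue measure.
   Context: $\|x\|$ denotes the distance from the real number $x$ to the nearest integer. *)

(* Defs.v *)
From mathcomp Require Import all_boot all_order all_algebra.
From mathcomp Require Import all_classical all_reals all_analysis.

Set Implicit Arguments.
Unset Strict Implicit.
Unset Printing Implicit Defensive.

Import Order.TTheory GRing.Theory Num.Theory.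
Import numFieldNormedType.Exports.

Local Open Scope classical_set_scope.
Local Open Scope ring_scope.

Definition dist_int (R : realType) (x : R) : R :=
  inf [set `|x - m%:~R| | m in [set: int]].

Definition quadratic_unit_gt1 (R : realType) (alpha : R) : Prop :=
  (exists2 b : int, 3 <= b
     & alpha = (b%:~R + Num.sqrt (b%:~R ^+ 2 - 4)) / 2) \/
  (exists2 b : int, 1 <= b
     & alpha = (b%:~R + Num.sqrt (b%:~R ^+ 2 + 4)) / 2).

(* The sequences are bounded (with values in [0, 1/2]), so the real-valued
   limn_sup is the genuine limit superior. *)
Definition spectrum (R : realType) (alpha : R) : set R :=
  [set limn_sup (fun n : nat => dist_int (xi * alpha ^+ n)) | xi in [set: R]].

(* Main.v *)
Require Import Defs.
From mathcomp Require Import all_boot all_order all_algebra.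
From mathcomp Require Import all_classical all_reals all_analysis.
From mathcomp Require Import lra ring zify.

Import Order.TTheory GRing.Theory Num.Theory.
Import numFieldNormedType.Exports.

Local Open Scope classical_set_scope.
Local Open Scope ring_scope.

(* Let [beta = N / alpha] be the conjugate of [alpha], [N = 1] or [N = -1], and
   [M = (alpha - beta) / 2].  For a bounded integer sequence [S] put
     [P n = \sum_(i >= n) S i * alpha ^ (n - i)],
     [Q n = \sum_(i < n) S i * beta ^ (n - i)].
   Since [alpha] and [beta] are conjugate, [xi = P 0 / (2 * M)] satisfies
   [xi * alpha ^ n = (P n + Q n) / (2 * M)] modulo 1.  As in Hall's theorem on
   the Markoff-Lagrange spectrum, the sum at a central position ranges over a sum
   of two Cantor sets (right and left digits), which fills an interval around
   [M] once the digit set is large enough.  On the other hand the digits can be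
   kept so small that [P n + Q n] stays below [M - 1 / 100] in absolute value at
   all other positions.  Concatenating longer and longer blocks built around such
   centres realises every [T / (2 * M)] with [M - 1 / 100 <= T <= M] as a limit
   superior.  With [b = alpha + beta], digits in [-m, m]
   with [m] about [b / 4] suffice unless [(N, b)] is one of [(-1, 3)], [(1, 4)],
   [(-1, 5)], [(1, 6)]: there the pairs of consecutive digits have to be
   restricted. *)

Set Implicit Arguments.
Unset Strict Implicit.
Unset Printing Implicit Defensive.

(** * Distance to the nearest integer and limits superior *)

Lemma dist_int_le (R : realType) (x : R) (m : int) : dist_int x <= `|x - m%:~R|.
Proof.
by apply: ge_inf; [exists 0 => _ [k _ <-] | exists m].
Qed.

Lemma dist_int_ge (R : realType) (x y : R) :
  (forall m : int, y <= `|x - m%:~R|) -> y <= dist_int x.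
Proof.
move=> h; apply: lb_le_inf => [|_ [m _ <-]]; last exact: h.
by exists `|x - 0%:~R|; exists 0.
Qed.

Lemma dist_int_addz (R : realType) (x : R) (m : int) :
  dist_int (x + m%:~R) = dist_int x.
Proof.
apply/le_anti/andP; split; apply: dist_int_ge => k.
  have := dist_int_le (x + m%:~R) (k + m).
  by rewrite intrD opprD addrACA subrr addr0.
by have := dist_int_le x (k - m); rewrite intrB opprB addrA (addrAC x).
Qed.

Lemma dist_int_lip (R : realType) (x y : R) :
  `|dist_int x - dist_int y| <= `|x - y|.
Proof.
have half (a b : R) : dist_int a - dist_int b <= `|a - b|.
  rewrite lerBlDr -lerBlDl; apply: dist_int_ge => m.
  rewrite lerBlDl; apply: (le_trans (dist_int_le a m)).
  by rewrite -(subrKA b) ler_normD.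
by rewrite ler_norml half andbT lerNl opprB distrC half.
Qed.

Lemma dist_int_id (R : realType) (x : R) : 0 <= x <= 1 / 2 -> dist_int x = x.
Proof.
move=> /andP[x0 x12]; apply/le_anti/andP; split.
  by have := dist_int_le x 0; rewrite subr0 ger0_norm.
apply: dist_int_ge => m.
have [m0|m0] := lerP m 0.
  have : (m%:~R : R) <= 0 by rewrite lerz0.
  by move=> ?; apply: le_trans (ler_norm _); lra.
have : 1 <= (m%:~R : R) by rewrite ler1z.
by move=> ?; rewrite distrC; apply: le_trans (ler_norm _); lra.
Qed.

(** The bound [B] makes the real-valued [sup] of each tail a true supremum rather than a default
    value. *)
Lemma limn_sup_eq (R : realType) (u : nat -> R) (t B : R) :
  (forall n, u n <= B) ->
  (forall e, 0 < e -> exists n0, forall n, (n0 <= n)%N -> u n <= t + e) ->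
  (forall e, 0 < e -> forall n, exists2 k, (n <= k)%N & t - e <= u k) ->
  limn_sup u = t.
Proof.
move=> uB ule uge; apply/cvg_lim => //.
have nonempty n : sdrop u n !=set0 by exists (u n); exists n => /=.
have le_sups e n : 0 < e -> t - e <= sups u n.
  move=> e0; have [k nk tk] := uge e e0 n; apply: (le_trans tk).
  apply: ub_le_sup; last by exists k.
  by exists B => _ [i _ <-].
apply/cvgrPdist_le => e e0; have [n0 hn0] := ule e e0.
exists n0 => // n /= n0n; rewrite distrC ler_norml.
apply/andP; split; first by have := le_sups e n e0; lra.
have : sups u n <= t + e.
  by apply: ge_sup => // _ [i /= ni <-]; apply/hn0/(leq_trans n0n).
by lra.
Qed.

(** Monotonicity is that of the outer measure, which applies to an arbitrary set [A]. *)
Lemma lebesgue_measure_gt0 (R : realType) (a b : R) (A : set R) :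
  a < b -> `[a, b] `<=` A -> (0 < lebesgue_measure A)%E.
Proof.
move=> ab abA; apply: (@lt_le_trans _ _ (lebesgue_measure `[a, b])).
  by rewrite lebesgue_measure_itv /= lte_fin ab -EFinB lte_fin subr_gt0.
exact: (le_outer_measure (mu_ext _)).
Qed.

(** * Words of digits *)

(* The mark [true] singles out the central positions. *)
Definition word := seq (int * bool).

Section Flow.
Context (R : realType) (alpha beta : R).

(** If [P] equals [x] right after [w], it equals [back w x] at the start of [w]; dually [forw w y]
    carries [Q] from the start of [w] to its end. *)
Definition back (w : word) (x : R) : R :=
  foldr (fun s y => s.1%:~R + y / alpha) x w.

Definition forw (w : word) (y : R) : R :=
  foldl (fun y s => beta * (s.1%:~R + y)) y w.

Lemma back_cat w1 w2 x : back (w1 ++ w2) x = back w1 (back w2 x).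
Proof. by rewrite /back foldr_cat. Qed.

Lemma forw_cat w1 w2 y : forw (w1 ++ w2) y = forw w2 (forw w1 y).
Proof. by rewrite /forw foldl_cat. Qed.

Lemma backB w x y : back w x - back w y = (x - y) / alpha ^+ size w.
Proof.
elim: w => [|s w IH]; first by rewrite divr1.
rewrite /= opprD addrACA subrr add0r -mulrBl IH.
by rewrite exprSr invfM mulrA.
Qed.

(* Flow-in bounds [pR] (from the right) and [qL] (from the left), flow-out
   bounds [pL] and [qR]. *)
Definition ok (K pL qL pR qR : R) (w : word) : Prop :=
  forall x y, `|x| <= pR -> `|y| <= qL ->
  [/\ `|back w x| <= pL, `|forw w y| <= qR &
      forall i, (i < size w)%N -> ~~ (nth (0, false) w i).2 ->
        `|back (drop i w) x + forw (take i w) y| <= K].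

Lemma ok_cat K pL qL p q pR qR w1 w2 : 0 <= p -> 0 <= q ->
  ok K pL qL p q w1 -> ok K p q pR qR w2 -> ok K pL qL pR qR (w1 ++ w2).
Proof.
move=> p0 q0 ok1 ok2 x y hx hy.
(* [forw w1 y] does not depend on the flow from the right, so the admissible input 0 yields its
   bound. *)
have n0 : `|0 : R| <= p by rewrite normr0.
have [_ hf _] := ok1 0 y n0 hy.
have [hb hf2 hv2] := ok2 x (forw w1 y) hx hf.
have [hb1 _ hv1] := ok1 (back w2 x) y hb hy.
rewrite back_cat forw_cat; split=> // i; rewrite size_cat nth_cat drop_cat take_cat.
case: (ltnP i (size w1)) => iw.
  by move=> _ hm; rewrite back_cat; exact: hv1.
move=> iw2 hm; rewrite forw_cat; apply: hv2 => //.
by rewrite ltn_subLR.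
Qed.

Lemma ler_back (w : word) (x y : R) : 0 < alpha -> (back w x <= back w y) = (x <= y).
Proof.
move=> a0; rewrite -subr_le0 backB pmulr_lle0 ?subr_le0 //.
by rewrite invr_gt0 exprn_gt0.
Qed.

End Flow.

(** * Concatenation of infinitely many blocks into one digit sequence *)

Section Glue.
Context (R : realType) (alpha beta : R) (B : nat -> word).
Hypothesis alpha_gt0 : 0 < alpha.
Hypothesis B_gt0 : forall j, (0 < size (B j))%N.

Local Notation back := (back alpha).
Local Notation forw := (forw beta).

Let flat j : word := flatten (mkseq B j).
Let start j := size (flat j).
(** Blocks are nonempty, so the first [n.+1] of them already contain position [n]. *)
Let S n := nth (0, false) (flat n.+1) n.

Let flatS j : flat j.+1 = flat j ++ B j.
Proof. by rewrite /flat mkseqS flatten_rcons. Qed.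

Let startS j : start j.+1 = (start j + size (B j))%N.
Proof. by rewrite /start flatS size_cat. Qed.

Let start_ge j : (j <= start j)%N.
Proof.
elim: j => // j IH; rewrite startS; have := B_gt0 j; lia.
Qed.

Let nth_flat j k n : (n < start j)%N -> (j <= k)%N ->
  nth (0, false) (flat k) n = nth (0, false) (flat j) n.
Proof.
move=> nj; elim: k => [|k IH]; first by rewrite leqn0 => /eqP ->.
rewrite leq_eqVlt => /orP[/eqP -> //|jk].
have le_start : (start j <= start k)%N.
  have {IH} : (j <= k)%N by [].
  elim: (k) => [|i IHi]; first by rewrite leqn0 => /eqP ->.
  rewrite leq_eqVlt => /orP[/eqP -> //|/IHi /leq_trans]; apply.
  by rewrite startS leq_addr.
rewrite flatS nth_cat (_ : (n < size (flat k))%N); last exact: leq_trans nj le_start.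
exact: IH.
Qed.

Let S_start j i : (i < size (B j))%N -> S (start j + i) = nth (0, false) (B j) i.
Proof.
move=> iB; have lt : (start j + i < start j.+1)%N by rewrite startS ltn_add2l.
rewrite /S (nth_flat lt); last first.
  by rewrite ltnS; apply: leq_trans (start_ge j) _; rewrite leq_addr.
by rewrite flatS nth_cat ltnNge leq_addr /= addKn.
Qed.

Let B_map j : map S (iota (start j) (size (B j))) = B j.
Proof.
apply: (@eq_from_nth _ (0, false)); rewrite size_map size_iota // => i iB.
by rewrite (nth_map 0%N) ?size_iota // nth_iota // S_start.
Qed.

Let flat_map j : map S (iota 0 (start j)) = flat j.
Proof.
elim: j => [//|j IH]; rewrite startS iotaD map_cat IH add0n B_map.
by rewrite flatS.
Qed.

Let locate n : exists j i, n = (start j + i)%N /\ (i < size (B j))%N.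
Proof.
elim: n => [|n [j [i [-> iB]]]]; first by exists 0%N, 0%N.
have [iB1|Bi1] := ltnP i.+1 (size (B j)); first by exists j, i.+1; rewrite addnS.
exists j.+1, 0%N; split=> //; rewrite startS; lia.
Qed.

(** [P] depends on all future digits. The first [j] blocks confine its initial value to the image of
    [[-p, p]] under [back]; these intervals are nested, and a common point [P0] determines all of
    [P]. *)
Lemma glue (K p q : R) : 0 <= p -> 0 <= q ->
  (forall j, ok alpha beta K p q p q (B j)) ->
  exists (D : nat -> int * bool) (P Q : nat -> R) (st : nat -> nat),
  [/\ forall n, P n = (D n).1%:~R + P n.+1 / alpha,
      Q 0 = 0 /\ forall n, Q n.+1 = beta * ((D n).1%:~R + Q n),
      forall j, (j <= st j)%N,
      forall n, exists j i, n = (st j + i)%N /\ (i < size (B j))%N &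
      forall j, st j.+1 = (st j + size (B j))%N /\ exists x y,
      [/\ `|x| <= p, `|y| <= q & forall i, (i < size (B j))%N ->
        [/\ D (st j + i) = nth (0, false) (B j) i,
            P (st j + i) = back (drop i (B j)) x &
            Q (st j + i) = forw (take i (B j)) y]]].
Proof.
move=> p0 q0 okB.
pose lo j := back (flat j) (- p); pose hi j := back (flat j) p.
have an0 : alpha != 0 by rewrite gt_eqF.
have loS j : lo j <= lo j.+1.
  rewrite /lo flatS back_cat ler_back //.
  have [| |/ler_normlP[h _] _ _] := okB j (- p) 0; first by rewrite normrN ger0_norm.
    by rewrite normr0.
  by lra.
have hiS j : hi j.+1 <= hi j.
  rewrite /hi flatS back_cat ler_back //.
  have [| |/ler_normlP[_ h] _ _ //] := okB j p 0; first by rewrite ger0_norm.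
  by rewrite normr0.
have lohi j : lo j <= hi j by rewrite /lo /hi ler_back //; lra.
have lo_mono j k : (j <= k)%N -> lo j <= lo k.
  elim: k => [|k IH]; first by rewrite leqn0 => /eqP ->.
  rewrite leq_eqVlt => /orP[/eqP -> //|/IH h]; exact: le_trans h (loS k).
have hi_mono j k : (j <= k)%N -> hi k <= hi j.
  elim: k => [|k IH]; first by rewrite leqn0 => /eqP ->.
  rewrite leq_eqVlt => /orP[/eqP -> //|/IH h]; exact: le_trans (hiS k) h.
have lo_hi j k : lo j <= hi k.
  apply: (le_trans (lo_mono _ _ (leq_maxl j k))).
  exact: le_trans (lohi _) (hi_mono _ _ (leq_maxr j k)).
pose P0 := sup (range lo).
have loP0 j : lo j <= P0.
  by apply: ub_le_sup; [exists (hi 0%N) => _ [k _ <-] | exists j].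
have P0hi j : P0 <= hi j.
  by apply: ge_sup; [exists (lo 0%N), 0%N | move=> _ [k _ <-]].
pose P := fix P n := if n is n'.+1 then alpha * (P n' - (S n').1%:~R) else P0.
pose Q := fix Q n := if n is n'.+1 then beta * ((S n').1%:~R + Q n') else 0.
have PE n : P n = (S n).1%:~R + P n.+1 / alpha.
  by rewrite /= mulrAC divff // mul1r addrC subrK.
have P_back n l : P n = back (map S (iota n l)) (P (n + l)%N).
  elim: l n => [|l IH] n; first by rewrite addn0.
  by rewrite /= addnS -addSn -IH -PE.
have Q_forw n l : Q (n + l)%N = forw (map S (iota n l)) (Q n).
  elim: l n => [|l IH] n; first by rewrite addn0.
  by rewrite addnS -addSn IH.
(* [back] is strictly increasing, so [lo j <= P0 <= hi j] pulls back to the bound at [start j]. *)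
have P_start j : `|P (start j)| <= p.
  have := P_back 0%N (start j); rewrite flat_map add0n => P0E.
  have := loP0 j; have := P0hi j; rewrite /lo /hi -[P0]/(P 0%N) P0E !ler_back //.
  by rewrite ler_norml => -> ->.
have Q_start j : `|Q (start j)| <= q.
  elim: j => [|j IH]; first by rewrite normr0.
  rewrite startS Q_forw B_map.
  have [|//|_ h _ //] := okB j 0 (Q (start j)).
  by rewrite normr0.
exists S, P, Q, start; split=> // j; split=> //.
exists (P (start j.+1)), (Q (start j)); split=> // i iB.
split; first exact: S_start.
- rewrite (P_back _ (size (B j) - i)%N) startS -addnA subnKC 1?ltnW //.
  by rewrite -{3}(B_map j) -map_drop drop_iota.
- by rewrite Q_forw -{1}(B_map j) -map_take take_iota (minn_idPl (ltnW iB)).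
Qed.

End Glue.

(** * From digit schemes to the spectrum *)

Section Scheme.
Context (R : realType) (alpha : R) (N b : int).
Hypothesis alpha_gt2 : 2 < alpha.
Hypothesis NE : N = 1 \/ N = -1.
Hypothesis alphaE : alpha ^+ 2 = b%:~R * alpha - N%:~R.

Let beta : R := N%:~R / alpha.
Let M : R := (alpha - beta) / 2.

Local Notation back := (back alpha).
Local Notation forw := (forw beta).
Local Notation ok := (ok alpha beta).

Let alpha_gt0 : 0 < alpha. Proof. by move: alpha_gt2; lra. Qed.

Let alpha_neq0 : alpha != 0. Proof. by rewrite gt_eqF. Qed.

Let betaE : beta = b%:~R - alpha.
Proof.
rewrite /beta; apply: (mulIf alpha_neq0); rewrite divfK // mulrBl.
by have := alphaE; rewrite expr2; lra.
Qed.

Let normNM (x : R) : `|N%:~R * x| = `|x|.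
Proof. by case: NE => ->; rewrite ?mul1r // mulrN1z mulN1r normrN. Qed.

Let M_gt0 : 0 < M.
Proof.
have : `|beta| < 1.
  rewrite /beta normNM normfV gtr0_norm // invf_lt1 //; move: alpha_gt2; lra.
by rewrite ltr_norml /M => /andP[_ ?]; move: alpha_gt2; lra.
Qed.

(** The digits before [n] make [alpha ^ n * P 0 - P n] an element [x + y * alpha] with integers [x],
    [y], and [Q n] is its conjugate [x + y * beta]. Their difference
    [y * (alpha - beta) = 2 * M * y] gives the integer [y]. *)
Lemma flow_integral (D : nat -> int * bool) (P Q : nat -> R) :
  (forall n, P n = (D n).1%:~R + P n.+1 / alpha) ->
  Q 0 = 0 -> (forall n, Q n.+1 = beta * ((D n).1%:~R + Q n)) ->
  forall n, exists k : int,
    P 0 / (2 * M) * alpha ^+ n = (P n + Q n) / (2 * M) + k%:~R.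
Proof.
move=> PE Q0 QE n.
have [x [y [hA hQ]]] : exists x y : int,
    alpha ^+ n * P 0 - P n = x%:~R + y%:~R * alpha /\ Q n = x%:~R + y%:~R * beta.
  elim: n => [|n [x [y [hA hQ]]]].
    by exists 0, 0; rewrite Q0 expr0; split; lra.
  have PS : P n.+1 = alpha * (P n - (D n).1%:~R).
    by rewrite (PE n); field.
  have beta2 : beta ^+ 2 = b%:~R * beta - N%:~R.
    by rewrite betaE; have := alphaE; rewrite !expr2; lra.
  exists (- N * y), (x + (D n).1 + b * y).
  rewrite !intrD !intrM intrN QE hQ; split.
    have -> : alpha ^+ n.+1 * P 0 - P n.+1 =
        alpha * (alpha ^+ n * P 0 - P n) + alpha * (D n).1%:~R.
      by rewrite PS exprS; ring.
    rewrite hA.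
    have -> : alpha * (x%:~R + y%:~R * alpha) + alpha * (D n).1%:~R =
      alpha * (x%:~R + (D n).1%:~R) + y%:~R * alpha ^+ 2 by ring.
    by rewrite alphaE; ring.
  have -> : beta * ((D n).1%:~R + (x%:~R + y%:~R * beta)) =
    beta * (x%:~R + (D n).1%:~R) + y%:~R * beta ^+ 2 by ring.
  by rewrite beta2; ring.
exists y; have M2 : alpha - beta = 2 * M by rewrite /M; field.
have M20 : 2 * M != 0 by rewrite mulf_neq0 // gt_eqF.
have E : P 0 * alpha ^+ n = P n + Q n + y%:~R * (2 * M).
  have -> : P 0 * alpha ^+ n = alpha ^+ n * P 0 - P n + P n by ring.
  by rewrite hA hQ -M2; ring.
by rewrite mulrAC E mulrDl mulfK.
Qed.

(* [(a, a')] are the digits at distance [2i+1], [2i+2] to the right of the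
   centre [s0], or, after the sign change [N ^ k], to its left. *)
Definition pair_ok (K p q : R) (a a' : int) : Prop :=
  forall x y : R, `|x| <= p -> `|y| <= q ->
  [/\ `|a%:~R + (a'%:~R + x / alpha) / alpha| <= p,
      `|beta * (a'%:~R + beta * (a%:~R + y))| <= q,
      `|a%:~R + (a'%:~R + x / alpha) / alpha + y| <= K &
      `|a'%:~R + x / alpha + beta * (a%:~R + y)| <= K].

(** [y] is [Q] just after the centre [s0], written through the left digits; their signs [N ^ k] turn
    powers of [beta] into powers of [1 / alpha], so that swapping the [a] and [b] digits describes
    the other side. *)
Definition side_ok (K p q : R) (s0 a1 a2 b1 b2 : int) : Prop :=
  forall x x' : R, `|x| <= p -> `|x'| <= p ->
  let y := beta * (s0%:~R + (b1%:~R + (b2%:~R + x' / alpha) / alpha) / alpha) in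
  [/\ `|a1%:~R + (a2%:~R + x / alpha) / alpha + y| <= K,
      `|a2%:~R + x / alpha + beta * (a1%:~R + y)| <= K &
      `|beta * (a2%:~R + beta * (a1%:~R + y))| <= q].

(* [p] and [q] bound [P] and [Q] between consecutive pairs of digits to the right
   of a centre, hence [alpha * q] and [p / alpha] do so to its left; [h] bounds
   the remainders in the joint expansion of the two sides; the last clause
   provides the centre and the first pair of digits on each side. *)
Definition scheme (W : int -> int -> Prop) (K p q h : R) : Prop :=
  [/\ 0 <= q <= p, 2 * q <= K,
      forall a a', W a a' -> pair_ok K p q a a',
      forall r : R, `|r| <= h -> exists a a' b b', [/\ W a a', W b b' &
        `|alpha ^+ 2 * r - alpha * (a + b)%:~R - (a' + b')%:~R| <= h] &
      forall T, K <= T <= M -> exists s0 a1 a2 b1 b2,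
        [/\ `|alpha ^+ 2 * (T - s0%:~R) - alpha * (a1 + b1)%:~R - (a2 + b2)%:~R|
              <= h,
            side_ok K p q s0 a1 a2 b1 b2 & side_ok K p q s0 b1 b2 a1 a2]].

Lemma ok_right K p q a a' : pair_ok K p q a a' ->
  ok K p q p q [:: (a, false); (a', false)].
Proof.
move=> h x y hx hy; have [h1 h2 h3 h4] := h x y hx hy.
by split=> //= -[|[|//]] _ _.
Qed.

(** Reversing a pair swaps the two flows: with the sign [N] on the digit nearer to the centre,
    [alpha * y] acts as the flow from the right and [N * (x / alpha)] as the flow from the left. *)
Lemma ok_left K p q a a' : pair_ok K p q a a' ->
  ok K (alpha * q) (p / alpha) (alpha * q) (p / alpha)
    [:: (a', false); (N * a, false)].
Proof.
move=> h x y hx hy.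
have [||h1 h2 h3 h4] := h (alpha * y) (N%:~R * (x / alpha)).
- by rewrite normrM gtr0_norm // mulrC -ler_pdivlMr.
- by rewrite normNM normrM normfV (gtr0_norm alpha_gt0) ler_pdivrMr // mulrC.
split=> /=.
- rewrite (_ : _ + _ = N%:~R * (alpha * (beta * (a'%:~R +
    beta * (a%:~R + N%:~R * (x / alpha)))))); last first.
    by rewrite intrM /beta; case: NE => ->; field.
  by rewrite normNM normrM gtr0_norm // ler_pM2l.
- rewrite ler_pdivlMr // -[X in _ * X](gtr0_norm alpha_gt0) -normrM.
  rewrite (_ : _ * _ = a%:~R + (a'%:~R + alpha * y / alpha) / alpha) //.
  by rewrite intrM /beta; case: NE => ->; field.
- move=> [|[|//]] _ _ /=.
    rewrite (_ : _ + y = a'%:~R + alpha * y / alpha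
      + beta * (a%:~R + N%:~R * (x / alpha))) //.
    by rewrite intrM /beta; case: NE => ->; field.
  rewrite (_ : _ + _ = N%:~R * (a%:~R + (a'%:~R + alpha * y / alpha) / alpha
      + N%:~R * (x / alpha))) ?normNM //.
  by rewrite intrM /beta; case: NE => ->; field.
Qed.

(** Two zeros shrink both flows by [alpha ^ 2], enough to pass from the bounds to the right of one
    centre to those to the left of the next. *)
Lemma ok_turn K p q : 0 <= q <= p -> 2 * q <= K ->
  ok K p q (alpha * q) (p / alpha) [:: (0, false); (0, false)].
Proof.
move=> /andP[q0 qp] qK x y hx hy.
have hx1 : `|x / alpha| <= q.
  by rewrite normrM normfV (gtr0_norm alpha_gt0) ler_pdivrMr // mulrC.
have inv1 (z : R) : `|z / alpha| <= `|z|.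
  rewrite normrM normfV (gtr0_norm alpha_gt0) ler_pdivrMr // ler_peMr //.
  by move: alpha_gt2; lra.
have hy1 : `|beta * y| = `|y / alpha|.
  by rewrite /beta -mulrA normNM mulrC.
split=> /=; rewrite ?add0r.
- exact: le_trans (inv1 _) (le_trans hx1 qp).
- rewrite ler_pdivlMr // -[X in _ * X](gtr0_norm alpha_gt0) -normrM.
  rewrite (_ : _ * _ = N%:~R * (beta * y)); last first.
    by rewrite /beta; case: NE => ->; field.
  rewrite normNM hy1; apply: le_trans (inv1 _) _; exact: le_trans hy qp.
- move=> [|[|//]] _ _ /=; rewrite ?add0r; apply: le_trans (ler_normD _ _) _.
    by have := inv1 (x / alpha); lra.
  by rewrite hy1; have := inv1 y; lra.
Qed.

Lemma ok_centre K p q s0 a1 a2 b1 b2 :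
  side_ok K p q s0 a1 a2 b1 b2 -> side_ok K p q s0 b1 b2 a1 a2 ->
  ok K (alpha * q) (p / alpha) p q
    [:: (b2, false); (N * b1, false); (s0, true); (a1, false); (a2, false)].
Proof.
move=> sR sL x y hx hy.
have hy' : `|alpha * y| <= p.
  by rewrite normrM gtr0_norm // mulrC -ler_pdivlMr.
have [r1 r2 r3] := sR x (alpha * y) hx hy'.
have [l1 l2 l3] := sL (alpha * y) x hy' hx.
have yE : beta * (s0%:~R + beta * ((N * b1)%:~R + beta * (b2%:~R + y))) =
    beta * (s0%:~R + (b1%:~R + (b2%:~R + alpha * y / alpha) / alpha) / alpha).
  by rewrite intrM /beta; case: NE => ->; field.
split=> /=.
- rewrite (_ : _ + _ = N%:~R * (alpha * (beta * (b2%:~R + beta * (b1%:~R +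
    beta * (s0%:~R + (a1%:~R + (a2%:~R + x / alpha) / alpha) / alpha))))));
    last by rewrite intrM /beta; case: NE => ->; field.
  by rewrite normNM normrM gtr0_norm // ler_pM2l.
- by rewrite yE.
- move=> [|[|[//|[|[|//]]]]] _ _ /=; rewrite ?yE //.
  + rewrite (_ : _ + y = b2%:~R + alpha * y / alpha + beta * (b1%:~R +
      beta * (s0%:~R + (a1%:~R + (a2%:~R + x / alpha) / alpha) / alpha))) //.
    by rewrite intrM /beta; case: NE => ->; field.
  + rewrite (_ : _ + _ = N%:~R * (b1%:~R + (b2%:~R + alpha * y / alpha) / alpha
      + beta * (s0%:~R + (a1%:~R + (a2%:~R + x / alpha) / alpha) / alpha)))
      ?normNM //.
    by rewrite intrM /beta; case: NE => ->; field.
Qed.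

(** * Blocks realising a prescribed value at their centre *)

Definition unmarked (w : word) := all (fun s => ~~ s.2) w.

Lemma ok_nil K p q : ok K p q p q [::].
Proof. by move=> x y hx hy; split. Qed.

(** Iterating the covering clause adds one pair to each side, nearest to the centre first, and
    replaces the remainder by another one bounded by [h], while the scale grows by [alpha ^ 2]. The
    identity is exact for all incoming flows [x] and [y]. *)
Lemma expansion W K p q h : scheme W K p q h ->
  forall n (r : R), `|r| <= h -> exists u v r',
  [/\ `|r'| <= h, unmarked u && unmarked v, ok K p q p q u,
      ok K (alpha * q) (p / alpha) (alpha * q) (p / alpha) v &
      forall x y, back u x + alpha * forw v y - alpha * r =
                  (x + alpha * y - alpha * r') / alpha ^+ n.*2].
Proof.
move=> [/andP[q0 qp] _ hW cover _]; have p0 := le_trans q0 qp.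
elim=> [|n IH] r hr.
  exists [::], [::], r; split=> //; do ?exact: ok_nil.
  by move=> x y /=; rewrite expr0 divr1.
have [a [a' [b' [b'' [Wa Wb]]]]] := cover r hr.
set r1 := alpha ^+ 2 * r - _ - _ => /IH [u [v [r' [hr' huv oku okv E]]]].
exists ([:: (a, false); (a', false)] ++ u),
  (v ++ [:: (b'', false); (N * b', false)]), r'; split=> //.
- by move: huv; rewrite /unmarked !all_cat /= !andbT.
- by apply: ok_cat oku => //; exact/ok_right/hW.
- apply: (ok_cat _ _ okv); last exact/ok_left/hW.
  + by rewrite mulr_ge0 // ltW.
  + by rewrite divr_ge0 // ltW.
move=> x y; rewrite back_cat forw_cat /=.
have -> : alpha ^+ n.+1.*2 = alpha ^+ 2 * alpha ^+ n.*2.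
  by rewrite doubleS -add2n exprD.
rewrite invfM [RHS]mulrA [RHS]mulrAC -E.
have -> : alpha * (beta * ((N * b')%:~R + beta * (b''%:~R + forw v y))) =
    b'%:~R + (b''%:~R + alpha * forw v y / alpha) / alpha.
  by rewrite intrM /beta; case: NE => ->; field.
by rewrite /r1 !intrD; field.
Qed.

Lemma block_exists W K p q h : scheme W K p q h ->
  forall (T : R) (n : nat), K <= T <= M -> exists (B : word) (c : nat),
  [/\ ok K (alpha * q) (p / alpha) (alpha * q) (p / alpha) B,
      (c < size B)%N,
      forall i, (i < size B)%N -> i != c -> ~~ (nth (0, false) B i).2 &
      forall x y, `|x| <= alpha * q -> `|y| <= p / alpha ->
        `|back (drop c B) x + forw (take c B) y - T|
          <= (2 * p + alpha * h) / alpha ^+ n.*2].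
Proof.
move=> hs T n hT; have [/andP[q0 qp] qK hW cover centre] := hs.
have p0 := le_trans q0 qp.
have [s0 [a1 [a2 [b1 [b2]]]]] := centre T hT.
set r := alpha ^+ 2 * _ - _ - _ => -[hr sR sL].
have [u [v [r' [hr' /andP[mu mv] oku okv E]]]] := expansion hs n hr.
have aq0 : 0 <= alpha * q by rewrite mulr_ge0 // ltW.
have pa0 : 0 <= p / alpha by rewrite divr_ge0 // ltW.
(* The block is [v], the centre with its first pairs, [u], and the two zeros of [ok_turn]; the
   centre has position [size A]. *)
pose A := v ++ [:: (b2, false); (N * b1, false)].
pose C := [:: (a1, false); (a2, false)] ++ u ++ [:: (0, false); (0, false)].
have BE : A ++ (s0, true) :: C = v ++ ([:: (b2, false); (N * b1, false);
    (s0, true); (a1, false); (a2, false)] ++ (u ++ [:: (0, false); (0, false)])).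
  by rewrite /A /C -catA.
have mA : unmarked A by rewrite /unmarked all_cat /= andbT.
have mC : unmarked C by rewrite /unmarked /= all_cat /= andbT.
exists (A ++ (s0, true) :: C), (size A); split.
- rewrite BE; apply: (ok_cat aq0 pa0 okv).
  apply: (ok_cat p0 q0 (ok_centre sR sL)).
  by apply: (ok_cat p0 q0 oku); apply: ok_turn; rewrite ?q0.
- by rewrite size_cat /= addnS ltnS leq_addr.
- move=> i iB ineq; rewrite nth_cat; case: ltnP => iA.
    exact: (all_nthP (0, false) mA).
  case E' : (i - size A)%N => [|k] /=.
    by move: ineq; rewrite eqn_leq iA andbT -subn_eq0 E'.
  apply: (all_nthP (0, false) mC).
  by move: iB; rewrite size_cat -ltn_subLR // E'.
move=> x y hx hy.
rewrite drop_size_cat // take_size_cat // /A /C forw_cat /= back_cat /=.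
set x1 := 0%:~R + _.
have hx1 : `|x1| <= p.
  have n0 : `|0 : R| <= q by rewrite normr0.
  have q01 : 0 <= q <= p by rewrite q0.
  by have [] := ok_turn q01 qK hx n0.
have a30 : 1 <= alpha ^+ 3 by rewrite exprn_ege1 // ltW; move: alpha_gt2; lra.
(* As [r] is what the first pairs leave of [T - s0], the error at the centre is that of the
   expansion divided by [alpha ^ 3]. *)
rewrite (_ : _ - T = (x1 + alpha * y - alpha * r') / alpha ^+ n.*2 / alpha ^+ 3).
  rewrite normrM normfV (ger0_norm (le_trans ler01 a30)) ler_pdivrMr; last by lra.
  rewrite normrM normfV (@ger0_norm _ (alpha ^+ n.*2)); last first.
    by rewrite exprn_ge0 // ltW.
  rewrite ler_pdivrMr ?exprn_gt0 // mulrAC divfK ?expf_neq0 //.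
  have hy' : `|alpha * y| <= p.
    by rewrite normrM gtr0_norm // mulrC -ler_pdivlMr.
  have hr'' : `|alpha * r'| <= alpha * h by rewrite normrM gtr0_norm // ler_pM2l.
  apply: (@le_trans _ _ (2 * p + alpha * h)).
    apply: le_trans (ler_normB _ _) _.
    by have := ler_normD x1 (alpha * y); lra.
  by rewrite ler_peMr //; have := le_trans (normr_ge0 _) hr''; lra.
rewrite -E intrM /beta /r !intrD; case: NE => ->; field.
all: by [].
Qed.

Lemma scheme_spectrum W K p q h : 0 <= K -> scheme W K p q h ->
  forall T, K <= T <= M -> spectrum alpha (T / (2 * M)).
Proof.
move=> K0 hs T hT; have [/andP[q0 qp] _ _ _ _] := hs.
have p0 := le_trans q0 qp.
have aq0 : 0 <= alpha * q by rewrite mulr_ge0 // ltW.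
have pa0 : 0 <= p / alpha by rewrite divr_ge0 // ltW.
(* Block [j] carries [j] further pairs on each side, so its centre misses [T] by
   [O(alpha ^ (- 2 * j))]. *)
have [B hB] := choice (fun n => block_exists hs n hT).
have [c {}hB] := choice hB.
have B0 j : (0 < size (B j))%N by have [_ /(leq_ltn_trans (leq0n _))] := hB j.
have okB j : ok K (alpha * q) (p / alpha) (alpha * q) (p / alpha) (B j).
  by have [] := hB j.
have [D [P [Q [st [PE [Q0 QE] st_ge loc stB]]]]] := glue alpha_gt0 B0 aq0 pa0 okB.
pose t := T / (2 * M); pose C := (2 * p + alpha * h) / (2 * M).
have M2 : 0 < 2 * M by rewrite mulr_gt0.
have t12 : 0 <= t <= 1 / 2.
  move/andP: hT => [KT TM]; apply/andP; split; last by rewrite ler_pdivrMr //; lra.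
  by apply: divr_ge0; [exact: le_trans KT | exact: ltW].
pose u n := dist_int (P 0 / (2 * M) * alpha ^+ n).
have uE n : u n = dist_int ((P n + Q n) / (2 * M)).
  by have [k kE] := flow_integral PE Q0 QE n; rewrite /u kE dist_int_addz.
have u_off j i : (i < size (B j))%N -> i != c j -> u (st j + i)%N <= t.
  move=> iB ic; have [_ [x [y [hx hy /(_ i iB) [_ PB QB]]]]] := stB j.
  have [_ _ /(_ i iB ic) mi _] := hB j.
  have [_ _ /(_ i iB mi) vK] := okB j x y hx hy.
  rewrite uE; apply: le_trans (dist_int_le _ 0) _; rewrite subr0.
  rewrite normrM normfV (gtr0_norm M2) ler_pM2r ?invr_gt0 // PB QB.
  by apply: le_trans vK _; case/andP: hT.
(* [dist_int] fixes [t], which lies in [[0, 1/2]], and is 1-Lipschitz, so the error at the centre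
   carries over. *)
have u_on j : `|u (st j + c j)%N - t| <= C / alpha ^+ j.*2.
  have [_ cB _ v] := hB j.
  have [_ [x [y [hx hy /(_ _ cB) [_ PB QB]]]]] := stB j.
  rewrite uE -[in X in _ - X](dist_int_id t12).
  apply: le_trans (dist_int_lip _ _) _.
  rewrite -mulrBl normrM normfV (gtr0_norm M2) PB QB /C mulrAC.
  by rewrite ler_pM2r ?invr_gt0 //; exact: v.
have decay e : 0 < e -> exists J, forall j, (J <= j)%N -> C / alpha ^+ j.*2 <= e.
  move=> e0; exists (Num.bound (`|C| / e)) => j Jj.
  have a0 : 0 < alpha ^+ j.*2 by rewrite exprn_gt0.
  rewrite ler_pdivrMr // mulrC -ler_pdivrMr //.
  apply: (@le_trans _ _ (`|C| / e)).
    by rewrite ler_pM2r ?invr_gt0 // ler_norm.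
  apply: ltW; apply: (lt_le_trans (archi_boundP _)).
    by rewrite divr_ge0 // ltW.
  apply: (@le_trans _ _ (2 ^ j.*2)%:R).
    rewrite ler_nat; apply: (leq_trans Jj); apply: ltnW.
    by apply: leq_ltn_trans (ltn_expl _ _) => //; rewrite -addnn leq_addr.
  by rewrite natrX lerXn2r ?nnegrE ?ler0n // ltW.
have C0 : 0 <= C.
  by have := le_trans (normr_ge0 _) (u_on 0%N); rewrite double0 expr0 divr1.
have u_le j i : (i < size (B j))%N -> u (st j + i)%N <= t + C / alpha ^+ j.*2.
  move=> iB; have [->|ic] := eqVneq i (c j).
    by have := u_on j; rewrite ler_distl => /andP[].
  apply: le_trans (u_off j i iB ic) _; rewrite lerDl divr_ge0 //.
  by rewrite exprn_ge0 // ltW.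
have st_mono j k : (j <= k)%N -> (st j <= st k)%N.
  elim: k => [|k IH]; first by rewrite leqn0 => /eqP ->.
  rewrite leq_eqVlt => /orP[/eqP -> //|/IH /leq_trans]; apply.
  by have [-> _] := stB k; rewrite leq_addr.
exists (P 0 / (2 * M)) => //; apply: (@limn_sup_eq _ _ _ (t + C)).
- move=> n; have [j [i [-> iB]]] := loc n; apply: le_trans (u_le j i iB) _.
  rewrite lerD2l ler_pdivrMr ?exprn_gt0 // ler_peMr //.
  by rewrite exprn_ege1 //; move: alpha_gt2; lra.
- move=> e e0; have [J hJ] := decay e e0; exists (st J) => n.
  have [j [i [-> iB]]] := loc n => Jn; apply: le_trans (u_le j i iB) _.
  rewrite lerD2l; apply: hJ; rewrite leqNgt; apply/negP => jJ.
  have [stE _] := stB j; have := st_mono _ _ jJ; rewrite stE leqNgt => /negP; apply.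
  by apply: leq_ltn_trans Jn _; rewrite ltn_add2l.
- move=> e e0 n; have [J hJ] := decay e e0; pose j := maxn J n.
  exists (st j + c j)%N.
    by apply: leq_trans (leq_addr _ _); apply: leq_trans (st_ge j); exact: leq_maxr.
  have := u_on j; rewrite ler_distl => /andP[tu _]; apply: le_trans tu.
  by rewrite lerB // hJ // leq_maxl.
Qed.

End Scheme.

(** * Digit schemes *)

(** Rounding to the nearest integer costs at most [1 / 2 <= h]; beyond [D] or [- D] the end point is
    within [h] by assumption. *)
Lemma round_clip (R : realType) (x h : R) (D : int) : 0 <= D -> 1 / 2 <= h ->
  `|x| <= D%:~R + h -> exists d : int, (- D <= d <= D) /\ `|x - d%:~R| <= h.
Proof.
move=> D0 h12; rewrite ler_norml => /andP[x1 x2].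
have [xD|Dx] := ltrP D%:~R x.
  by exists D; split; [lia | rewrite ler_norml; apply/andP; split; lra].
have [xD'|Dx'] := ltrP x (- D%:~R).
  exists (- D); split; first lia.
  by rewrite intrN ler_norml; apply/andP; split; lra.
exists (Num.floor (x + 1 / 2)); split.
  apply/andP; split.
    by rewrite floor_ge_int intrN; lra.
  by rewrite -ltzD1 floor_lt_int intrD; lra.
have := floor_le (x + 1 / 2); have := floorD1_gt (x + 1 / 2).
by rewrite intrD ler_norml => ? ?; apply/andP; split; lra.
Qed.

(** A greedy expansion in base [alpha]: the first rounding leaves at most [1 / 2], the second at
    most [h]. Raising [h] above [1 / 2] allows a smaller [D'] at the price of a condition on [D]. *)
Lemma box_cover (R : realType) (alpha h : R) (D D' : int) :
  2 < alpha -> 0 <= D -> 0 <= D' -> 1 / 2 <= h ->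
  alpha * h <= D%:~R + 1 / 2 -> alpha / 2 <= D'%:~R + h ->
  forall r, `|r| <= h -> exists d d', [/\ - D <= d <= D, - D' <= d' <= D' &
    `|alpha ^+ 2 * r - alpha * d%:~R - d'%:~R| <= h].
Proof.
move=> alpha_gt2 D0 D'0 h12 hD hD' r hr; have a0 : 0 < alpha by lra.
have [|d [dD hd]] := @round_clip R (alpha * r) (1 / 2) D D0 (lexx _).
  by rewrite normrM gtr0_norm //; apply: (le_trans _ hD); rewrite ler_pM2l.
have [|d' [d'D hd']] := @round_clip R (alpha * (alpha * r - d%:~R)) h D' D'0 h12.
  rewrite normrM gtr0_norm //; apply: (le_trans _ hD').
  by rewrite ler_pM2l //; apply: le_trans hd _; lra.
exists d, d'; split=> //.
rewrite (_ : _ - _ = alpha * (alpha * r - d%:~R) - d'%:~R) //.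
by ring.
Qed.

Lemma split_digit (m m' d : int) : 0 <= m -> 0 <= m' -> - (m + m') <= d <= m + m' ->
  exists a b : int, [/\ a + b = d, - m <= a <= m & - m' <= b <= m'].
Proof.
move=> m0 m'0 hd; have [h|h] := lerP m d.
  by exists m, (d - m); split; lia.
have [h'|h'] := lerP d (- m); first by exists (- m), (d + m); split; lia.
by exists d, 0; split; lia.
Qed.

Lemma cover_sym (R : realType) (alpha h : R) (W : int -> int -> Prop) :
  (forall a a', W a a' -> W (- a) (- a')) ->
  (forall r, 0 <= r <= h -> exists a a' b b', [/\ W a a', W b b' &
     `|alpha ^+ 2 * r - alpha * (a + b)%:~R - (a' + b')%:~R| <= h]) ->
  forall r, `|r| <= h -> exists a a' b b', [/\ W a a', W b b' &
     `|alpha ^+ 2 * r - alpha * (a + b)%:~R - (a' + b')%:~R| <= h].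
Proof.
move=> WN hW r; have [r0|r0] := lerP 0 r => hr.
  by apply: hW; rewrite r0; move: hr; rewrite ger0_norm.
have [|a [a' [b [b' [Wa Wb H]]]]] := hW (- r).
  by move: hr; rewrite ltr0_norm // => ->; rewrite andbT oppr_ge0 ltW.
exists (- a), (- a'), (- b), (- b'); split; do ?exact: WN.
rewrite -normrN; move: H; congr (`|_| <= h).
by rewrite !intrD !intrN; ring.
Qed.

Definition box (m m' a a' : int) : Prop := - m <= a <= m /\ - m' <= a' <= m'.

Lemma norm_int_le (R : realType) (m a : int) :
  - m <= a <= m -> `|a%:~R : R| <= m%:~R.
Proof. by move=> /andP[h1 h2]; rewrite ler_norml -intrN !ler_int h1 h2. Qed.

(** * Sufficient inequalities for pairs and centres *)

Section Verification.
Context (R : realType) (alpha : R) (N : int).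
Hypothesis alpha_gt2 : 2 < alpha.
Hypothesis NE : N = 1 \/ N = -1.

Local Notation rho := (alpha^-1).
Local Notation nu := (N%:~R : R).
Local Notation pair_ok := (pair_ok alpha N).
Local Notation side_ok := (side_ok alpha N).

Let rho_gt0 : 0 < rho. Proof. by rewrite invr_gt0; move: alpha_gt2; lra. Qed.

Let alpha_neq0 : alpha != 0. Proof. by rewrite -invr_eq0 gt_eqF. Qed.

Let normN : `|nu| = 1.
Proof. by case: NE => ->; rewrite ?normrN1 ?normr1. Qed.

Let norm_rho (x : R) : `|rho * x| = rho * `|x|.
Proof. by rewrite normrM gtr0_norm. Qed.

Lemma pair_ok_bound (K p q u v : R) (a a' : int) :
  `|a%:~R + rho * a'%:~R| <= u -> `|a'%:~R + nu * rho * a%:~R| <= v ->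
  u + rho ^+ 2 * p <= p -> rho * v + rho ^+ 2 * q <= q ->
  u + rho ^+ 2 * p + q <= K -> v + rho * p + rho * q <= K ->
  pair_ok K p q a a'.
Proof.
move=> hu hv h1 h2 h3 h4 x y hx hy.
have e1 : `|a%:~R + (a'%:~R + x / alpha) / alpha| <= u + rho ^+ 2 * p.
  rewrite [X in `|X|](_ : _ = a%:~R + rho * a'%:~R + rho * (rho * x)); last by field.
  apply: le_trans (ler_normD _ _) (lerD hu _).
  by rewrite !norm_rho expr2 -mulrA !ler_pM2l.
have e2 : `|a'%:~R + (N%:~R / alpha) * (a%:~R + y)| <= v + rho * q.
  rewrite [X in `|X|](_ : _ = a'%:~R + nu * rho * a%:~R + nu * (rho * y));
    last by field.
  apply: le_trans (ler_normD _ _) (lerD hv _).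
  by rewrite normrM normN mul1r norm_rho ler_pM2l.
split; first exact: (le_trans e1 h1).
- rewrite !normrM normN mul1r (gtr0_norm rho_gt0); apply: (le_trans _ h2).
  by rewrite expr2 -mulrA -mulrDr ler_pM2l.
- by apply: le_trans (ler_normD _ _) (le_trans (lerD e1 hy) h3).
- apply: (le_trans _ h4).
  rewrite [X in `|X|](_ : _ = a'%:~R + N%:~R / alpha * (a%:~R + y) + rho * x);
    last by field.
  rewrite [leRHS]addrAC; apply: le_trans (ler_normD _ _) (lerD e2 _).
  by rewrite norm_rho ler_pM2l.
Qed.

(** The left tail [x'] shifts the flow [y] of the fixed digits by at most [rho ^ 4 * p <= c]. *)
Lemma side_ok_bound (K p q c u v : R) (s0 a1 a2 b1 b2 : int) :
  let y := nu * rho * (s0%:~R + rho * (b1%:~R + rho * b2%:~R)) in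
  rho ^+ 4 * p <= c ->
  `|a1%:~R + rho * a2%:~R + y| <= u -> `|a2%:~R + nu * rho * (a1%:~R + y)| <= v ->
  u + rho ^+ 2 * p + c <= K -> v + rho * p + rho * c <= K ->
  rho * v + rho ^+ 2 * c <= q ->
  side_ok K p q s0 a1 a2 b1 b2.
Proof.
move=> y hc hu hv h1 h2 h3 x x' hx hx' y'.
pose d := nu * (rho ^+ 4 * x').
have hd : `|d| <= c.
  apply: (le_trans _ hc); rewrite normrM normN mul1r normrM gtr0_norm ?exprn_gt0 //.
  by rewrite ler_pM2l ?exprn_gt0.
have y'E : y' = y + d by rewrite /y' /y /d; field.
have e2 : `|a2%:~R + N%:~R / alpha * (a1%:~R + y')| <= v + rho * c.
  rewrite [X in `|X|](_ : _ = a2%:~R + nu * rho * (a1%:~R + y) + nu * (rho * d)).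
    apply: le_trans (ler_normD _ _) (lerD hv _).
    by rewrite normrM normN mul1r norm_rho ler_pM2l.
  by rewrite y'E; field.
split.
- apply: (le_trans _ h1).
  rewrite [X in `|X|](_ : _ = a1%:~R + rho * a2%:~R + y + rho * (rho * x) + d).
    apply: le_trans (ler_normD _ _) (lerD _ hd).
    apply: le_trans (ler_normD _ _) (lerD hu _).
    by rewrite !norm_rho expr2 -mulrA !ler_pM2l.
  by rewrite y'E; field.
- apply: (le_trans _ h2).
  rewrite [X in `|X|](_ : _ = a2%:~R + N%:~R / alpha * (a1%:~R + y') + rho * x).
    rewrite [leRHS]addrAC; apply: le_trans (ler_normD _ _) (lerD e2 _).
    by rewrite norm_rho ler_pM2l.
  by field.
- rewrite !normrM normN mul1r (gtr0_norm rho_gt0); apply: (le_trans _ h3).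
  by rewrite expr2 -mulrA -mulrDr ler_pM2l.
Qed.

Lemma box_digit_bound (m m' a a' : int) (e : R) : `|e| = 1 -> box m m' a a' ->
  `|a%:~R + e * rho * a'%:~R| <= m%:~R + rho * m'%:~R.
Proof.
move=> e1 [ha ha']; apply: le_trans (ler_normD _ _) (lerD (norm_int_le _ ha) _).
by rewrite -mulrA normrM e1 mul1r norm_rho ler_pM2l ?norm_int_le.
Qed.

Lemma pair_ok_box (K p q : R) (m m' a a' : int) : box m m' a a' ->
  m%:~R + rho * m'%:~R + rho ^+ 2 * p <= p ->
  rho * (m'%:~R + rho * m%:~R) + rho ^+ 2 * q <= q ->
  m%:~R + rho * m'%:~R + rho ^+ 2 * p + q <= K ->
  m'%:~R + rho * m%:~R + rho * p + rho * q <= K ->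
  pair_ok K p q a a'.
Proof.
move=> [ha ha']; apply: pair_ok_bound.
  by have := @box_digit_bound m m' a a' 1 (normr1 _) (conj ha ha'); rewrite mul1r.
by apply: box_digit_bound => //; split.
Qed.

(** [p] is the geometric sum [m / (1 - rho)]. [q] bounds [Q] just after a centre of size at most
    [M + 1 / 2], so [side_ok] follows from [pair_ok]. Both sides together offer every digit in
    [[-2 * m, 2 * m]], which covers with remainder [1 / 2] when [alpha <= 4 * m + 1]. *)
Lemma scheme_box (m : int) (p : R) :
  let M := (alpha - nu / alpha) / 2 in
  let q := rho * (M + 1 / 2 + rho * p) in
  let K := M - 1 / 100 in
  1 <= m -> p = m%:~R + rho * p -> alpha <= 4 * m%:~R + 1 ->
  rho * p <= q -> q <= p -> 2 * q <= K -> p + q <= K ->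
  scheme alpha N (box m m) K p q (1 / 2).
Proof.
move=> M q K m1 pE am pq qp qK pqK; have r0 := rho_gt0.
have m0 : 0 <= m by exact: le_trans m1.
have p0 : 0 <= p.
  have m0R : (0 : R) <= m%:~R by rewrite ler0z.
  have : rho < 1 by rewrite invf_lt1; move: alpha_gt2; lra.
  move=> r1; have : 0 <= (1 - rho) * p by rewrite mulrBl mul1r {1}pE addrK.
  by rewrite pmulr_rge0 // subr_gt0.
have q0 : 0 <= q by apply: le_trans pq; rewrite mulr_ge0 // ltW.
have pE2 : p = m%:~R + rho * m%:~R + rho ^+ 2 * p.
  by rewrite {1}pE {1}pE; ring.
have hp a a' : box m m a a' -> pair_ok K p q a a'.
  move=> h; apply: (pair_ok_box h); rewrite -?pE2 //.
    have : rho * p <= q by [].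
    have -> : rho * (m%:~R + rho * m%:~R) = rho * p - rho ^+ 2 * (rho * p).
      by rewrite {1}pE2; ring.
    have : 0 <= (1 - rho ^+ 2) * (q - rho * p).
      rewrite mulr_ge0 ?subr_ge0 // expr_le1 ?(ltW r0) //.
      by rewrite invf_le1; move: alpha_gt2; lra.
    by lra.
  apply: (le_trans _ pqK); have : 0 <= (1 - rho) * (q - rho * p).
    by rewrite mulr_ge0 ?subr_ge0 // invf_le1; move: alpha_gt2; lra.
  have : rho * p = rho * m%:~R + rho ^+ 2 * p by rewrite {1}pE; ring.
  by have := pE; lra.
have cover (r : R) : `|r| <= 1 / 2 -> exists a a' b b',
    [/\ box m m a a', box m m b b' &
    `|alpha ^+ 2 * r - alpha * (a + b)%:~R - (a' + b')%:~R| <= 1 / 2].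
  move=> hr; have m2 : 0 <= m + m by rewrite addr_ge0.
  have [||d [d' [hd hd' H]]] :=
    @box_cover _ _ (1 / 2) _ _ alpha_gt2 m2 m2 (lexx _) _ _ r hr.
  - by rewrite intrD; lra.
  - by rewrite intrD; lra.
  have [a [b [E ha hb]]] := split_digit m0 m0 hd.
  have [a' [b' [E' ha' hb']]] := split_digit m0 m0 hd'.
  by exists a, a', b, b'; rewrite E E'.
split=> //; first by rewrite q0.
move=> T /andP[KT]; rewrite -/M => TM.
have T0 : 0 <= T by lra.
pose s0 := Num.floor (T + 1 / 2).
have /andP[f1 f2] := floor_itv (T + 1 / 2); rewrite intrD -/s0 in f1 f2.
have hs0 : `|T - s0%:~R| <= 1 / 2 by rewrite ler_norml; apply/andP; split; lra.
have [a1 [a2 [b1 [b2 [ha hb H]]]]] := cover _ hs0.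
have side a a' c c' : box m m a a' -> box m m c c' -> side_ok K p q s0 a a' c c'.
  move=> haa hcc x x' hx hx' y.
  have n0 : `|0 : R| <= q by rewrite normr0.
  have [c1 _ _ _] := hp _ _ hcc x' 0 hx' n0.
  have hy : `|y| <= q.
    rewrite /y !normrM normN mul1r (gtr0_norm rho_gt0) ler_pM2l //.
    apply: le_trans (ler_normD _ _) (lerD _ _).
      by rewrite ler_norml; apply/andP; split; lra.
    by rewrite mulrC norm_rho ler_pM2l.
  by have [h1 h2 h3 h4] := hp _ _ haa x y hx hy.
by exists s0, a1, a2, b1, b2; split=> //; exact: side.
Qed.

End Verification.

(** * Explicit schemes for small [b] *)

Lemma scheme_neg5 (R : realType) (alpha r K : R) (N : int) :
  alpha^-1 = r -> alpha = 5 + r -> 0 < r -> r ^+ 2 = 1 - 5 * r ->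
  N = -1 -> K = (alpha + r) / 2 - 1 / 100 ->
  exists W p q h, scheme alpha N W K p q h.
Proof.
move=> rE aE r0 r2 NE KE.
have r_lo : 5 / 26 < r by nra.
have r_hi : r < 26 / 135 by nra.
have r3 : r ^+ 3 = 26 * r - 5 by rewrite exprS r2; lra.
have r4 : r ^+ 4 = 26 - 135 * r by rewrite exprS r3; lra.
have r4' : r ^+ 4 <= 1 / 676 by rewrite (exprD r 2 2) r2; nra.
have a2 : 2 < alpha by lra.
have N1 : N = 1 \/ N = -1 by right.
(* [alpha > 5] excludes [m = 1] in [scheme_box], and [m = 2] would push [p + q] above [K]. Second
   digits up to 1 suffice once remainders up to [4 / 5] are allowed. *)
exists (box 2 1), (57 / 25), (7 / 25), (4 / 5); split.
- by lra.
- by lra.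
- by move=> a a' haa; apply: (pair_ok_box a2 N1 haa); rewrite rE ?r2; lra.
- move=> s hs.
  have [|||d [d' [hd hd' H]]] :=
    @box_cover _ _ (4 / 5) 4 2 a2 isT isT _ _ _ s hs.
  + by lra.
  + by lra.
  + by lra.
  have [a [a1 [Ea ha ha1]]] := @split_digit 2 2 d isT isT hd.
  have [a' [a1' [Ea' ha' ha1']]] := @split_digit 1 1 d' isT isT hd'.
  by exists a, a', a1, a1'; rewrite Ea Ea'; split.
(* [T] is within [1 / 100] of [M], so one centre with fixed first pairs serves every [T]. *)
move=> T /andP[KT TM]; exists 3, (-1), 1, (-1), 1.
have side : side_ok alpha N K (57 / 25) (7 / 25) 3 (-1) 1 (-1) 1.
  by apply: (@side_ok_bound _ _ _ a2 N1 _ _ _ (1 / 200) (7 / 5) (7 / 5));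
    rewrite rE ?NE ?r2 ?ler_norml; lra.
split=> //.
have {}TM : T <= (alpha + r) / 2 by move: TM; rewrite rE NE; lra.
have a22 : alpha ^+ 2 = 26 + 5 * r by rewrite aE; lra.
pose e := (alpha + r) / 2 - T.
have TE : T = (alpha + r) / 2 - e by rewrite /e; lra.
have e0 : 0 <= e by rewrite /e; lra.
have : 0 <= r * e by rewrite mulr_ge0 // ltW.
by rewrite a22 ler_norml TE aE => H; apply/andP; split; nra.
Qed.

Lemma scheme_neg3 (R : realType) (alpha r K : R) (N : int) :
  alpha^-1 = r -> alpha = 3 + r -> 0 < r -> r ^+ 2 = 1 - 3 * r ->
  N = -1 -> K = (alpha + r) / 2 - 1 / 100 ->
  exists W p q h, scheme alpha N W K p q h.
Proof.
move=> rE aE r0 r2 NE KE.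
have r_lo : 33 / 109 < r by nra.
have r_hi : r < 10 / 33 by nra.
have r3 : r ^+ 3 = 10 * r - 3 by rewrite exprS r2; lra.
have r4 : r ^+ 4 = 10 - 33 * r by rewrite exprS r3; lra.
have r4' : r ^+ 4 <= 1 / 100 by rewrite (exprD r 2 2) r2; nra.
have a2 : 2 < alpha by lra.
have N1 : N = 1 \/ N = -1 by right.
have a22 : alpha ^+ 2 = 10 + 3 * r by rewrite aE; lra.
(* With [N = -1] a pair contributes [a' - r * a] at its second position; equal signs keep this
   within 1 instead of [1 + r]. *)
pose W (a a' : int) := box 1 1 a a' /\ 0 <= a * a'.
exists W, (36 / 25), (17 / 50), (33 / 50); split.
- by lra.
- by lra.
- move=> a a' [[ha ha'] haa].
  apply: (@pair_ok_bound _ _ _ a2 N1 _ _ _ (1 + r) 1); rewrite rE ?r2; try lra.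
  + have : a = -1 \/ a = 0 \/ a = 1 by clear -ha; lia.
    have : a' = -1 \/ a' = 0 \/ a' = 1 by clear -ha'; lia.
    by case=> [->|[->|->]] [->|[->|->]]; rewrite ler_norml;
      clear -r_lo r_hi; lra.
  + have : a = -1 \/ a = 0 \/ a = 1 by clear -ha; lia.
    have : a' = -1 \/ a' = 0 \/ a' = 1 by clear -ha'; lia.
    by case=> [E|[E|E]] [E'|[E'|E']]; move: haa; rewrite E E' NE // => _;
      rewrite ler_norml; clear -r_lo r_hi; lra.
- apply: cover_sym => [a a' [[ha ha'] haa]|s /andP[s0 s1]].
    by split; [split; clear -ha ha'; lia | rewrite mulrNN].
  have y1 : alpha ^+ 2 * s <= (10 + 3 * r) * (33 / 50) by rewrite a22; nra.
  have y0 : 0 <= alpha ^+ 2 * s by rewrite a22; nra.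
  move: (alpha ^+ 2 * s) y0 y1 => y y0 y1.
  (* The sums used are 0, 1, [alpha - 1], [alpha], [alpha + 1], [alpha + 2], [2 * alpha], with
     thresholds at the midpoints. The largest gap [alpha - 2] is below [2 * h = 33 / 25]. *)
  have [h1|h1] := lerP y (1 / 2).
    by exists 0, 0, 0, 0; split=> //; rewrite ler_norml aE; lra.
  have [h2|h2] := lerP y (alpha / 2).
    by exists 0, 1, 0, 0; split=> //; rewrite ler_norml aE; lra.
  have [h3|h3] := lerP y (alpha - 1 / 2).
    by exists 1, 0, 0, (-1); split=> //; rewrite ler_norml aE; lra.
  have [h4|h4] := lerP y (alpha + 1 / 2).
    by exists 1, 0, 0, 0; split=> //; rewrite ler_norml aE; lra.
  have [h5|h5] := lerP y (alpha + 3 / 2).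
    by exists 1, 1, 0, 0; split=> //; rewrite ler_norml aE; lra.
  have [h6|h6] := lerP y (3 / 2 * alpha + 1).
    by exists 1, 1, 0, 1; split=> //; rewrite ler_norml aE; lra.
  by exists 1, 0, 1, 0; split=> //; rewrite ler_norml aE; lra.
move=> T /andP[KT TM]; exists 2, 0, (-1), 0, (-1).
have side : side_ok alpha N K (36 / 25) (17 / 50) 2 0 (-1) 0 (-1).
  by apply: (@side_ok_bound _ _ _ a2 N1 _ _ _ (1 / 50) (9 / 10) (17 / 20));
    rewrite rE ?NE ?r2 ?ler_norml; lra.
split=> //.
have {}TM : T <= (alpha + r) / 2 by move: TM; rewrite rE NE; lra.
pose e := (alpha + r) / 2 - T.
have TE : T = (alpha + r) / 2 - e by rewrite /e; lra.
have e0 : 0 <= e by rewrite /e; lra.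
have : 0 <= r * e by rewrite mulr_ge0 // ltW.
by rewrite a22 ler_norml TE aE => H; apply/andP; split; nra.
Qed.

Lemma scheme_pos4 (R : realType) (alpha r K : R) (N : int) :
  alpha^-1 = r -> alpha = 4 - r -> 0 < r <= 1 / 3 -> r ^+ 2 = 4 * r - 1 ->
  N = 1 -> K = (alpha - r) / 2 - 1 / 100 ->
  exists W p q h, scheme alpha N W K p q h.
Proof.
move=> rE aE /andP[r0 r13] r2 NE KE.
have r_lo : 15 / 56 < r by nra.
have r_hi : r < 11 / 41 by nra.
have r3 : r ^+ 3 = 15 * r - 4 by rewrite exprS r2; lra.
have r4 : r ^+ 4 = 56 * r - 15 by rewrite exprS r3; lra.
have r4' : r ^+ 4 <= 1 / 100 by rewrite (exprD r 2 2) r2; nra.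
have a2 : 2 < alpha by lra.
have N1 : N = 1 \/ N = -1 by left.
have a22 : alpha ^+ 2 = 15 - 4 * r by rewrite aE; lra.
(* With [N = 1] a pair contributes [a + r * a'] and [a' + r * a]; opposite signs keep both within
   1. *)
pose W (a a' : int) := box 1 1 a a' /\ a * a' <= 0.
exists W, (27 / 25), (29 / 100), (1 / 2); split.
- by lra.
- by lra.
- move=> a a' [[ha ha'] haa].
  have : a = -1 \/ a = 0 \/ a = 1 by clear -ha; lia.
  have : a' = -1 \/ a' = 0 \/ a' = 1 by clear -ha'; lia.
  move=> ea' ea.
  apply: (@pair_ok_bound _ _ _ a2 N1 _ _ _ 1 1); rewrite rE ?r2; try lra.
  + by case: ea ea' => [E|[E|E]] [E'|[E'|E']]; move: haa; rewrite E E' // => _;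
      rewrite ler_norml; clear -r_lo r_hi; lra.
  + by case: ea ea' => [E|[E|E]] [E'|[E'|E']]; move: haa; rewrite E E' NE // => _;
      rewrite ler_norml; clear -r_lo r_hi; lra.
- apply: cover_sym => [a a' [[ha ha'] haa]|s /andP[s0 s1]].
    by split; [split; clear -ha ha'; lia | rewrite mulrNN].
  have y1 : alpha ^+ 2 * s <= (15 - 4 * r) / 2 by rewrite a22; nra.
  have y0 : 0 <= alpha ^+ 2 * s by rewrite a22; nra.
  move: (alpha ^+ 2 * s) y0 y1 => y y0 y1.
  (* Consecutive sums are at most [1 = 2 * h] apart, and the last one, [2 * alpha - 1], just reaches
     [alpha ^ 2 / 2 = 2 * alpha - 1 / 2]. *)
  have [h1|h1] := lerP y (1 / 2).
    by exists 0, 0, 0, 0; split=> //; rewrite ler_norml aE; lra.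
  have [h2|h2] := lerP y ((alpha - 1) / 2).
    by exists 0, 1, 0, 0; split=> //; rewrite ler_norml aE; lra.
  have [h3|h3] := lerP y (alpha - 3 / 2).
    by exists 1, (-1), 0, (-1); split=> //; rewrite ler_norml aE; lra.
  have [h4|h4] := lerP y (alpha - 1 / 2).
    by exists 1, (-1), 0, 0; split=> //; rewrite ler_norml aE; lra.
  have [h5|h5] := lerP y (alpha + 1 / 2).
    by exists 1, 0, 0, 0; split=> //; rewrite ler_norml aE; lra.
  have [h6|h6] := lerP y (alpha + 3 / 2).
    by exists 1, 0, 0, 1; split=> //; rewrite ler_norml aE; lra.
  have [h7|h7] := lerP y (2 * alpha - 3 / 2).
    by exists 1, (-1), 1, (-1); split=> //; rewrite ler_norml aE; lra.
  by exists 1, 0, 1, (-1); split=> //; rewrite ler_norml aE; lra.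
(* [M = 2 - r], so the centre 2 and the single digit -1 represent [M] with remainder 0. *)
move=> T /andP[KT TM]; exists 2, (-1), 0, 0, 0.
split.
- have {}TM : T <= (alpha - r) / 2 by move: TM; rewrite rE NE; lra.
  pose e := (alpha - r) / 2 - T.
  have TE : T = (alpha - r) / 2 - e by rewrite /e; lra.
  have e0 : 0 <= e by rewrite /e; lra.
  have : 0 <= r * e by rewrite mulr_ge0 // ltW.
  by rewrite a22 ler_norml TE aE => H; apply/andP; split; nra.
- by apply: (@side_ok_bound _ _ _ a2 N1 _ _ _ (1 / 50) (1 / 2) (1 / 5));
    rewrite rE ?NE ?r2 ?ler_norml; lra.
- by apply: (@side_ok_bound _ _ _ a2 N1 _ _ _ (1 / 50) (1 / 2) (1 / 5));
    rewrite rE ?NE ?r2 ?ler_norml; lra.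
Qed.

Lemma scheme_pos6 (R : realType) (alpha r K : R) (N : int) :
  alpha^-1 = r -> alpha = 6 - r -> 0 < r <= 1 / 3 -> r ^+ 2 = 6 * r - 1 ->
  N = 1 -> K = (alpha - r) / 2 - 1 / 100 ->
  exists W p q h, scheme alpha N W K p q h.
Proof.
move=> rE aE /andP[r0 r13] r2 NE KE.
have r_lo : 6 / 35 < r by nra.
have r_hi : r < 29 / 169 by nra.
have r3 : r ^+ 3 = 35 * r - 6 by rewrite exprS r2; lra.
have r4 : r ^+ 4 = 204 * r - 35 by rewrite exprS r3; lra.
have r4' : r ^+ 4 <= 1 / 200 by rewrite (exprD r 2 2) r2; nra.
have a2 : 2 < alpha by lra.
have N1 : N = 1 \/ N = -1 by left.
have a22 : alpha ^+ 2 = 35 - 6 * r by rewrite aE; lra.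
(* One side takes a pair from [box 2 1], the other from [box 1 2]: the joint digits reach 3 in both
   places, yet no pair has two digits of size 2. *)
exists (fun a a' => box 2 1 a a' \/ box 1 2 a a'), (56 / 25), (39 / 100), (1 / 2).
split.
- by lra.
- by lra.
- move=> a a' haa.
  apply: (@pair_ok_bound _ _ _ a2 N1 _ _ _ (2 + r) (2 + r));
    try by rewrite rE ?r2; lra.
  + case: haa => /(@box_digit_bound _ _ a2 _ _ _ _ 1 (normr1 _));
      rewrite rE mul1r => h;
      apply: le_trans h _; lra.
  + case: haa => -[ha ha'].
      have := @box_digit_bound _ _ a2 _ _ _ _ 1 (normr1 _) (conj ha' ha).
      by rewrite rE NE !mul1r => h; apply: le_trans h _; lra.
    have := @box_digit_bound _ _ a2 _ _ _ _ 1 (normr1 _) (conj ha' ha).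
    by rewrite rE NE !mul1r => h; apply: le_trans h _; lra.
- move=> s hs.
  have [|||d [d' [hd hd' H]]] :=
    @box_cover _ _ (1 / 2) 3 3 a2 isT isT _ _ _ s hs.
  + by lra.
  + by lra.
  + by lra.
  have [a [a1 [Ea ha ha1]]] := @split_digit 2 1 d isT isT hd.
  have [a' [a1' [Ea' ha' ha1']]] := @split_digit 1 2 d' isT isT hd'.
  by exists a, a', a1, a1'; rewrite Ea Ea'; split=> //; [left | right].
move=> T /andP[KT TM]; exists 3, (-1), 0, 0, 0.
split.
- have {}TM : T <= (alpha - r) / 2 by move: TM; rewrite rE NE; lra.
  pose e := (alpha - r) / 2 - T.
  have TE : T = (alpha - r) / 2 - e by rewrite /e; lra.
  have e0 : 0 <= e by rewrite /e; lra.
  have : 0 <= r * e by rewrite mulr_ge0 // ltW.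
  by rewrite a22 ler_norml TE aE => H; apply/andP; split; nra.
- by apply: (@side_ok_bound _ _ _ a2 N1 _ _ _ (1 / 50) (1 / 2) (1 / 5));
    rewrite rE ?NE ?r2 ?ler_norml; lra.
- by apply: (@side_ok_bound _ _ _ a2 N1 _ _ _ (1 / 50) (1 / 2) (1 / 5));
    rewrite rE ?NE ?r2 ?ler_norml; lra.
Qed.

(** [scheme_box] applies with [m = 1], but [2 * m <= b - 3] fails, so its inequalities are checked
    from bounds on [r]; likewise for [b = 6] with [m = 2]. *)
Lemma scheme_neg4 (R : realType) (alpha r K : R) (N : int) :
  alpha^-1 = r -> alpha = 4 + r -> 0 < r -> r ^+ 2 = 1 - 4 * r ->
  N = -1 -> K = (alpha + r) / 2 - 1 / 100 ->
  exists W p q h, scheme alpha N W K p q h.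
Proof.
move=> rE aE r0 r2 NE KE.
have r_lo : 13 / 56 < r by nra.
have r_hi : r < 1 / 4 by nra.
have a2 : 2 < alpha by lra.
have N1 : N = 1 \/ N = -1 by right.
pose p : R := 1 / (1 - r).
have p1 : p * (1 - r) = 1 by rewrite /p divfK // gt_eqF //; lra.
have p_lo : 1 <= p by nra.
have p_hi : p <= 4 / 3 by nra.
have KE' : K = (alpha - N%:~R / alpha) / 2 - 1 / 100 by rewrite KE rE NE; lra.
have qE : r * ((alpha - N%:~R * r) / 2 + 1 / 2 + r * p) = p - 5 / 2 * r.
  by rewrite NE aE; nra.
exists (box 1 1), p, (p - 5 / 2 * r), (1 / 2).
rewrite -qE -rE KE'; apply: scheme_box => //; rewrite ?rE ?qE ?NE; lra.
Qed.

Lemma scheme_neg6 (R : realType) (alpha r K : R) (N : int) :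
  alpha^-1 = r -> alpha = 6 + r -> 0 < r -> r ^+ 2 = 1 - 6 * r ->
  N = -1 -> K = (alpha + r) / 2 - 1 / 100 ->
  exists W p q h, scheme alpha N W K p q h.
Proof.
move=> rE aE r0 r2 NE KE.
have r_lo : 6 / 37 < r by nra.
have r_hi : r < 1 / 6 by nra.
have a2 : 2 < alpha by lra.
have N1 : N = 1 \/ N = -1 by right.
pose p : R := 2 / (1 - r).
have p1 : p * (1 - r) = 2 by rewrite /p divfK // gt_eqF //; lra.
have p_lo : 2 <= p by nra.
have p_hi : p <= 12 / 5 by nra.
have KE' : K = (alpha - N%:~R / alpha) / 2 - 1 / 100 by rewrite KE rE NE; lra.
have qE : r * ((alpha - N%:~R * r) / 2 + 1 / 2 + r * p) = p - 1 - 9 / 2 * r.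
  by rewrite NE aE; nra.
exists (box 2 2), p, (p - 1 - 9 / 2 * r), (1 / 2).
rewrite -qE -rE KE'; apply: scheme_box => //; rewrite ?rE ?qE ?NE; lra.
Qed.

(** * Choice of a scheme for every [alpha >= 3] *)

Lemma digit_bound_pos (b : int) : 3 < b -> b != 4 -> b != 6 ->
  exists m : int, [/\ 1 <= m, 2 * m <= b - 3 & b <= 4 * m + 1].
Proof. by move=> b3 b4 b6; exists ((b + 2) %/ 4)%Z; split; lia. Qed.

(** For [N = -1], [alpha = b + 1 / alpha] exceeds [b], so [alpha <= 4 * m + 1] is drawn from
    [b <= 4 * m]. *)
Lemma digit_bound_neg (b : int) :
  2 < b -> b != 3 -> b != 4 -> b != 5 -> b != 6 ->
  exists m : int, [/\ 1 <= m, 2 * m <= b - 3 & b <= 4 * m].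
Proof. by move=> b2 b3 b4 b5 b6; exists ((b + 3) %/ 4)%Z; split; lia. Qed.

Section Quadratic.
Context (R : realType) (alpha : R) (N b : int).
Hypothesis alpha_ge3 : 3 <= alpha.
Hypothesis NE : N = 1 \/ N = -1.
Hypothesis alphaE : alpha ^+ 2 = b%:~R * alpha - N%:~R.

Local Notation rho := (alpha^-1).
Local Notation M := ((alpha - N%:~R / alpha) / 2).
Local Notation K := (M - 1 / 100).

Let alpha_gt2 : 2 < alpha. Proof. by move: alpha_ge3; lra. Qed.

Let alpha_neq0 : alpha != 0. Proof. by rewrite gt_eqF //; move: alpha_ge3; lra. Qed.

Let rho_itv : 0 < rho <= 1 / 3.
Proof.
rewrite invr_gt0 div1r lef_pV2 ?posrE; first by move: alpha_ge3; lra.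
all: by move: alpha_ge3; lra.
Qed.

Let alpha_rho : alpha = b%:~R - N%:~R * rho.
Proof.
apply: (mulIf alpha_neq0); rewrite mulrBl -mulrA mulVf // mulr1 -expr2.
exact: alphaE.
Qed.

Let rho2 : rho ^+ 2 = N%:~R * (b%:~R * rho - 1).
Proof.
have a1 : rho * alpha = 1 by rewrite mulVf.
have : rho * alpha = b%:~R * rho - N%:~R * rho ^+ 2.
  by rewrite {2}alpha_rho; ring.
by rewrite a1; case: NE => -> h; lra.
Qed.

Lemma scheme_large (m : int) :
  1 <= m -> 2 * m <= b - 3 -> alpha <= 4 * m%:~R + 1 ->
  exists W p q h, scheme alpha N W K p q h.
Proof.
move=> m1 mb am; have /andP[r0 r3] := rho_itv.
pose p : R := m%:~R / (1 - rho).
have mbR : 2 * (m%:~R : R) <= b%:~R - 3.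
  have : ((2 * m)%:~R : R) <= (b - 3)%:~R by rewrite ler_int.
  by rewrite intrM intrB; lra.
have m1R : 1 <= (m%:~R : R) by rewrite ler1z.
have pE : p = m%:~R + rho * p.
  have r1 : 1 - rho != 0 by rewrite gt_eqF //; lra.
  have : p * (1 - rho) = m%:~R by rewrite /p divfK.
  by lra.
have rhoM : rho * M = (1 - N%:~R * rho ^+ 2) / 2.
  by field.
set mu := rho * p in pE.
have muE : (1 - rho) * mu = rho * m%:~R.
  by have : mu = rho * (m%:~R + mu) by [rewrite -pE]; lra.
have mu0 : 0 <= mu.
  have : 0 <= (1 - rho) * mu by rewrite muE mulr_ge0; lra.
  by rewrite pmulr_rge0 // subr_gt0; lra.
have rb : rho * b%:~R = 1 + N%:~R * rho ^+ 2.
  by rewrite rho2; case: NE => ->; lra.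
(* [rho * m <= (rho * b - 3 * rho) / 2 = (1 + N * rho ^ 2 - 3 * rho) / 2], which is at most
   [(1 - rho) / 2]. *)
have mu1 : mu <= 1 / 2.
  have : 0 <= rho * (b%:~R - 3 - 2 * m%:~R) by rewrite mulr_ge0; lra.
  have : 0 <= (1 - rho) * (1 / 2 - mu) -> mu <= 1 / 2.
    by rewrite pmulr_rge0 ?subr_ge0 // subr_gt0; lra.
  move=> h H; apply: h; case: NE => E; move: rb; rewrite E; nra.
exists (box m m), p, (rho * (M + 1 / 2 + rho * p)), (1 / 2).
have b_al := alpha_rho.
have M2 : 2 * M = alpha - N%:~R * rho by field.
apply: scheme_box => //; rewrite -/mu.
all: by rewrite !mulrDr rhoM; case: NE => E; rewrite E in M2 b_al rb *; nra.
Qed.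

Let M_gt1 : 1 < M.
Proof.
have [r rE] : exists r, rho = r by exists rho.
have := rho_itv; rewrite rE => /andP[r0 r3].
have : N%:~R * r <= r by case: NE => ->; lra.
by move: alpha_ge3; lra.
Qed.

Lemma exists_scheme : exists W p q h, scheme alpha N W K p q h.
Proof.
have a3 := alpha_ge3; have [r rE] : exists r, rho = r by exists rho.
have aE := alpha_rho; have r2 := rho2; have /andP[r0 r3] := rho_itv.
rewrite rE in aE r2 r0 r3.
case: NE => E.
  rewrite E mulr1z ?mul1r in r2 aE; have b3 : 3 < b by rewrite -(ltr_int R); lra.
  have KE : K = (alpha - r) / 2 - 1 / 100 by rewrite E rE; lra.
  have [Eb|b4] := eqVneq b 4.
    rewrite Eb in r2 aE; by apply: (@scheme_pos4 _ alpha r) => //; lra.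
  have [Eb|b6] := eqVneq b 6.
    rewrite Eb in r2 aE; by apply: (@scheme_pos6 _ alpha r) => //; lra.
  have [m [m1 m2 m3]] := digit_bound_pos b3 b4 b6.
  apply: (scheme_large m1 m2).
  have : ((b : int)%:~R : R) <= (4 * m + 1)%:~R by rewrite ler_int.
  by rewrite intrD intrM; lra.
rewrite E mulrN1z ?mulN1r ?opprK in r2 aE.
have b2 : 2 < b by rewrite -(ltr_int R); lra.
have KE : K = (alpha + r) / 2 - 1 / 100 by rewrite E rE; lra.
have [Eb|b3] := eqVneq b 3.
  by rewrite Eb in r2 aE; apply: (@scheme_neg3 _ alpha r) => //; lra.
have [Eb|b4] := eqVneq b 4.
  by rewrite Eb in r2 aE; apply: (@scheme_neg4 _ alpha r) => //; lra.
have [Eb|b5] := eqVneq b 5.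
  by rewrite Eb in r2 aE; apply: (@scheme_neg5 _ alpha r) => //; lra.
have [Eb|b6] := eqVneq b 6.
  by rewrite Eb in r2 aE; apply: (@scheme_neg6 _ alpha r) => //; lra.
have [m [m1 m2 m3]] := digit_bound_neg b2 b3 b4 b5 b6.
apply: (scheme_large m1 m2).
have : ((b : int)%:~R : R) <= (4 * m)%:~R by rewrite ler_int.
by rewrite intrM; lra.
Qed.

Lemma spectrum_upper T : K <= T <= M -> spectrum alpha (T / (2 * M)).
Proof.
have [W [p [q [h hs]]]] := exists_scheme.
apply: (scheme_spectrum alpha_gt2 NE alphaE _ hs).
by have := M_gt1; lra.
Qed.

Lemma spectrum_itv :
  exists kappa : R, kappa < 1 / 2 /\ `[kappa, 1 / 2] `<=` spectrum alpha.
Proof.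
have M1 := M_gt1.
have M20 : 0 < 2 * M by lra.
exists (K / (2 * M)); split; first by rewrite ltr_pdivrMr //; lra.
move=> t /=; rewrite in_itv /= ler_pdivrMr // => /andP[t1 t2].
have M2n : 2 * M != 0 by rewrite gt_eqF.
rewrite -(mulfK M2n t); apply: spectrum_upper; rewrite t1 /=.
have := ler_wpM2r (ltW M20) t2; lra.
Qed.

End Quadratic.

Unset Implicit Arguments.

Theorem theorem7p3 (R : realType) (alpha : R)
    (halpha : quadratic_unit_gt1 alpha) (halpha3 : 3 <= alpha) :
  (exists kappa : R, kappa < 1 / 2 /\ `[kappa, 1 / 2] `<=` spectrum alpha) /\
  (0 < lebesgue_measure (spectrum alpha))%E.
Proof.
have [kappa [k2 hk]] :
    exists kappa : R, kappa < 1 / 2 /\ `[kappa, 1 / 2] `<=` spectrum alpha.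
  (* The two shapes of [alpha] are roots of [x ^ 2 - b * x + N] with [N = 1] and [N = -1]. *)
  case: halpha => -[b b0 E].
    apply: (@spectrum_itv _ alpha 1 b) => //; first by left.
    have b3 : (3 : R) <= b%:~R by rewrite (ler_int R 3).
    have s : Num.sqrt (b%:~R ^+ 2 - 4 : R) ^+ 2 = b%:~R ^+ 2 - 4.
      by rewrite sqr_sqrtr //; nra.
    by rewrite E; nra.
  apply: (@spectrum_itv _ alpha (-1) b) => //; first by right.
  have s : Num.sqrt (b%:~R ^+ 2 + 4 : R) ^+ 2 = b%:~R ^+ 2 + 4.
    by rewrite sqr_sqrtr //; nra.
  by rewrite E; nra.
split; first by exists kappa.
exact: lebesgue_measure_gt0 k2 hk.
Qed.
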